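(* Let $T$ and $B$ be lattice paths with steps $N=(0,1)$ and $E=(1,0)$ from the origin to a point $(x,y)\in\mathbb N^2$, with $T$ weakly above $B$. For $P\in\mathcal P(T,B)$ let $t(P)$ be the number of top contacts and $b(P)$ the number of bottom contacts of $P$. Then the joint distribution of $(t,b)$ over $\mathcal P(T,B)$ is symmetric, i.e. $$\sum_{P\in\mathcal P(T,B)} u^{t(P)}v^{b(P)}=\sum_{P\in\mathcal P(T,B)} u^{b(P)}v^{t(P)}.$$
   Context: $T$ weakly above $B$ means no point of $T$ is strictly below or strictly to the right of $B$. $\mathcal P(T,B)$ is the set of lattice paths with steps $N$ and $E$ from the origin to $(x,y)$ lying weakly above $B$ and weakly below $T$. A top contact of $P$ is an east step of $P$ that is also a step of $T$; a bottom contact is an east step of $P$ that is also a step of $B$. *)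

(* Defs.v *)
From HB Require Import structures.
From mathcomp Require Import all_boot all_order all_algebra.

Set Implicit Arguments.
Unset Strict Implicit.
Unset Printing Implicit Defensive.

Inductive step := North | East.

Definition bool_of_step (s : step) : bool := if s is North then true else false.
Definition step_of_bool (b : bool) : step := if b then North else East.

Lemma bool_of_stepK : cancel bool_of_step step_of_bool.
Proof. by case. Qed.

HB.instance Definition _ := Finite.copy step (can_type bool_of_stepK).

(* A lattice path starting at the origin is given by its sequence of steps. *)
Definition endpoint (s : seq step) : nat * nat :=
  (count_mem East s, count_mem North s).

Definition is_path_to (x y : nat) (s : seq step) : bool :=
  endpoint s == (x, y).

Definition point_at (s : seq step) (k : nat) : nat * nat :=
  endpoint (take k s).

Definition points (s : seq step) : seq (nat * nat) :=
  [seq point_at s k | k <- iota 0 (size s).+1].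

(* A path may meet a vertical (resp. horizontal) line in several points; p is  *)
(* strictly below (resp. strictly to the right of) the path when the path      *)
(* meets the line through p and all the points where it does lie above (resp.  *)
(* to the left of) p. In particular a point on the path is neither.            *)
Definition strictly_below (p : nat * nat) (s : seq step) : bool :=
  has (fun q => q.1 == p.1) (points s) &&
  all (fun q => (q.1 == p.1) ==> (p.2 < q.2)) (points s).

Definition strictly_right (p : nat * nat) (s : seq step) : bool :=
  has (fun q => q.2 == p.2) (points s) &&
  all (fun q => (q.2 == p.2) ==> (q.1 < p.1)) (points s).

Definition weakly_above (T B : seq step) : bool :=
  all (fun p => ~~ (strictly_below p B || strictly_right p B)) (points T).

(* A path to (x, y) has exactly x + y steps, so tuples of that length range    *)
(* over all of them.                                                           *)
Definition paths_between (x y : nat) (T B : seq step) :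
    {set (x + y).-tuple step} :=
  [set P : (x + y).-tuple step |
    [&& is_path_to x y P, weakly_above P B & weakly_above T P]].

(* An east step, as a segment of the plane, is determined by its left end.     *)
Definition east_steps (s : seq step) : seq (nat * nat) :=
  [seq point_at s k | k <- iota 0 (size s) & nth North s k == East].

Definition contacts (P Q : seq step) : nat :=
  count (fun p => p \in east_steps Q) (east_steps P).

(* Main.v *)
(* A path is determined by the heights of its east steps, and lying between B
   and T means that each height lies between the corresponding ones of B and T.
   Hence the generating function g_i(k) of the initial parts ending at (i, k)
   obeys g_(i+1)(k) = \sum_(j <= k) w_i(j) g_i(j), where w_i(j) is 0 outside
   [b_i, t_i] and otherwise carries a factor u when j = t_i and v when j = b_i.
   Let g'_i be the same function with u and v exchanged. There is a function h_i,
   invariant under the exchange, such that g_i - g'_i = (v - u) h_i, which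
   vanishes from t_(i-1) on, and such that above b_(i-1)
     g_i(k+1) - g_i(k) = u h_i(k) + (1 - u) h_i(k+1).
   It is given by h_0 = 0 and h_(i+1)(k) = g_i(k) + u h_i(k) for
   b_i <= k < t_i, and 0 elsewhere. At the common endpoint h vanishes. *)
Require Import Defs.
From mathcomp Require Import all_boot all_order all_algebra.
From mathcomp Require Import zify ring.
Import GRing.Theory.

Set Implicit Arguments.
Unset Strict Implicit.
Unset Printing Implicit Defensive.

(** * Heights of the east steps of a path *)

(* For [a] at least the number of east steps this is the number of north steps,
   which makes [height s] monotone on all of [nat]. *)
Fixpoint height (s : seq step) (a : nat) : nat :=
  match s with
  | [::] => 0
  | North :: s' => (height s' a).+1
  | East :: s' => if a is a'.+1 then height s' a' else 0
  end.

Lemma height_le_count (s : seq step) (a : nat) : height s a <= count_mem North s.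
Proof. by elim: s a => [|[] s IHs] [|a] //=; rewrite ?add1n ?ltnS ?add0n ?IHs. Qed.

Lemma height_leS (s : seq step) (a : nat) : height s a <= height s a.+1.
Proof. by elim: s a => [|[] s IHs] [|a] //=; apply: IHs. Qed.

Definition count_upto (c : step) (s : seq step) (m : nat) : nat :=
  count_mem c (take m s).

Lemma count_upto_leq (c : step) (s : seq step) (m : nat) : count_upto c s m <= m.
Proof.
by apply: leq_trans (count_size _ _) _; rewrite size_take_min geq_minl.
Qed.

(** Both sides say that the east step of index [a] is among the first [a + k + 1] steps. *)
Lemma height_leq (s : seq step) (a k : nat) : a < count_mem East s ->
  (height s a <= k) = (count_upto North s (a + k).+1 <= k).
Proof.
elim: s a k => [|[] s IHs] a k //=.
- case: k => [|k]; first by rewrite addn0.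
  by rewrite add0n => ha; rewrite /count_upto /= addnS add1n !ltnS IHs.
- case: a => [|a] ha.
    by rewrite !add0n; apply/esym/count_upto_leq.
  by rewrite /count_upto /= add0n addSn; apply: IHs.
Qed.

Lemma east_steps_rcons (s : seq step) (c : step) :
  east_steps (rcons s c) =
  east_steps s ++ (if c is East then [:: endpoint s] else [::]).
Proof.
rewrite /east_steps size_rcons -addn1 iotaD filter_cat map_cat add0n; congr (_ ++ _).
  rewrite (@eq_in_filter _ _ (fun k => nth North s k == East)); last first.
    by move=> k; rewrite mem_iota add0n => /= hk; rewrite nth_rcons hk.
  apply/eq_in_map => k; rewrite mem_filter mem_iota add0n => /= /andP[_ hk].
  by rewrite /point_at -cats1 takel_cat // ltnW.
rewrite /= nth_rcons ltnn eqxx; case: c => //=.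
by rewrite /point_at -cats1 take_size_cat.
Qed.

Lemma height_rcons (s : seq step) (c : step) (a : nat) : a < count_mem East s ->
  height (rcons s c) a = height s a.
Proof.
by elim: s a => [|[] s IHs] [|a] //= ha; rewrite IHs.
Qed.

Lemma height_rcons_East (s : seq step) :
  height (rcons s East) (count_mem East s) = count_mem North s.
Proof. by elim: s => [|[] s IHs] //=; rewrite add0n IHs. Qed.

Lemma east_stepsE (s : seq step) :
  east_steps s = [seq (a, height s a) | a <- iota 0 (count_mem East s)].
Proof.
elim/last_ind: s => [|s c IHs] //.
rewrite east_steps_rcons IHs -cats1 count_cat cats1 iotaD map_cat add0n.
congr (_ ++ _).
  by apply/eq_in_map => a; rewrite mem_iota => /= ha; rewrite height_rcons.
by case: c => //=; rewrite height_rcons_East.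
Qed.

Lemma mem_east_steps (s : seq step) (a k : nat) : a < count_mem East s ->
  ((a, k) \in east_steps s) = (k == height s a).
Proof.
move=> ha; rewrite east_stepsE; apply/mapP/eqP => [[c _ [-> ->]] // | ->].
by exists a; rewrite // mem_iota.
Qed.

(** * Comparison of two paths by antidiagonals and by heights *)

Lemma count_East_North (s : seq step) : count_mem East s + count_mem North s = size s.
Proof. by elim: s => [|[] s IHs] //=; rewrite -IHs add0n add1n ?addnS ?addSn. Qed.

Lemma count_upto_le (c : step) (s : seq step) (m m' : nat) : m <= m' ->
  count_upto c s m <= count_upto c s m'.
Proof.
by move=> le_mm'; rewrite /count_upto -[m'](subnKC le_mm') takeD count_cat leq_addr.
Qed.

Lemma count_upto_East_North (s : seq step) (m : nat) : m <= size s ->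
  count_upto East s m + count_upto North s m = m.
Proof. by move=> hm; rewrite /count_upto count_East_North size_takel. Qed.

(** Discrete intermediate values: one more step raises the count by at most one. *)
Lemma count_upto_surj (c : step) (s : seq step) (k m : nat) :
  k <= count_upto c s m -> exists2 m', m' <= m & count_upto c s m' = k.
Proof.
elim: m => [|m IHm]; first by rewrite /count_upto take0 leqn0 => /eqP ->; exists 0; rewrite ?take0.
case: (leqP k (count_upto c s m)) => [/IHm[m' hm' <-] _|hlt hle].
  by exists m'; rewrite // leqW.
exists m.+1 => //; apply/eqP; rewrite eqn_leq hle andbT.
suff : count_upto c s m.+1 <= (count_upto c s m).+1 by lia.
rewrite /count_upto -[m.+1]addn1 takeD count_cat -[leqRHS]addn1 leq_add2l.
exact: count_upto_leq.
Qed.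

Lemma pointsP (s : seq step) (p : nat * nat) :
  reflect (exists2 m, m <= size s & p = (count_upto East s m, count_upto North s m))
    (p \in points s).
Proof.
apply: (iffP mapP) => -[m hm ->]; exists m => //.
  by rewrite mem_iota ltnS in hm.
by rewrite mem_iota ltnS.
Qed.

Lemma mem_points (s : seq step) (m : nat) : m <= size s ->
  (count_upto East s m, count_upto North s m) \in points s.
Proof. by move=> hm; apply/pointsP; exists m. Qed.

(* A path has one point on each antidiagonal, so the two can be compared there. *)
Lemma weakly_above_diagonal (P B : seq step) : size P = size B ->
  weakly_above P B <->
  (forall m, m <= size B -> count_upto North B m <= count_upto North P m).
Proof.
move=> hPB; split=> [/allP above m hm | above].
  have hmP : m <= size P by rewrite hPB.
  have := count_upto_East_North hm; have := count_upto_East_North hmP => eP eB.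
  rewrite leqNgt; apply/negP => lt_PB.
  have := above _ (mem_points hmP).
  (* Where [P] is lower than [B] on an antidiagonal, it is also further right. [B] has reached the
     height of this point of [P] earlier, and only earlier, so the point is strictly to the right of
     [B]. *)
  rewrite negb_or => /andP[_ /negP]; apply; apply/andP; split.
    have [m' hm' e] := count_upto_surj (ltnW lt_PB).
    by apply/hasP; exists (count_upto East B m', count_upto North B m');
      [apply/mem_points/(leq_trans hm') | rewrite /= e].
  apply/allP => q /pointsP[m' hm' ->]; apply/implyP => /= /eqP e.
  have lt_m : m' < m.
    by rewrite ltnNge; apply/negP => /(count_upto_le North B); rewrite e leqNgt lt_PB.
  by have := count_upto_le East B (ltnW lt_m); lia.
apply/allP => p /pointsP[m hmP ->]; have hm : m <= size B by rewrite -hPB.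
have hle := above m hm.
have := count_upto_East_North hm; have := count_upto_East_North hmP => eP eB.
(* In both cases monotonicity along [B] from [m] to [m'], or back, forces [B] and [P] to have the
   same point at index [m], against strictness. *)
apply/negP => /orP[] /andP[/hasP[q /pointsP[m' hm' ->]] /eqP e /allP h]; rewrite /= in e;
  have /implyP/(_ (introT eqP e)) /= lt_n := h _ (mem_points hm');
  have /implyP /= := h _ (mem_points hm).
- have lt_m : m < m'.
    by rewrite ltnNge; apply/negP => /(count_upto_le North B); lia.
  by have := count_upto_le East B (ltnW lt_m); lia.
- have lt_m : m' < m.
    by rewrite ltnNge; apply/negP => /(count_upto_le East B); lia.
  by have := count_upto_le North B (ltnW lt_m); lia.
Qed.

Lemma weakly_above_height (x y : nat) (P B : seq step) :
  is_path_to x y P -> is_path_to x y B ->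
  weakly_above P B = [forall a : 'I_x, height B a <= height P a].
Proof.
move=> /eqP[xP yP] /eqP[xB yB].
have hPB : size P = size B by rewrite -!count_East_North xP yP xB yB.
apply/idP/forallP => [/(weakly_above_diagonal hPB) above a|hle].
  rewrite height_leq ?xB //.
  have ha : height P a <= height P a by [].
  rewrite height_leq ?xP // in ha; apply: leq_trans ha.
  have [hm|/ltnW hm] := leqP (a + height P a).+1 (size B); first exact: above.
  by rewrite /count_upto !take_oversize ?hPB // yB yP.
apply/(weakly_above_diagonal hPB) => m hm.
have hmP : m <= size P by rewrite hPB.
have eP := count_upto_East_North hmP.
(* The last east step of [P] before index [m], of index [a], decides the comparison there. If there
   is none, [P] has only gone north. *)
case ea : (count_upto East P m) => [|a].
  by rewrite ea add0n in eP; rewrite eP count_upto_leq.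
have ltax : a < x.
  by rewrite -xP -[in X in _ < X](cat_take_drop m P) count_cat -/(count_upto _ _ _) ea ltn_addr.
set k := count_upto North P m.
have em : m = (a + k).+1 by rewrite -eP ea.
rewrite {1}em -height_leq ?xB //; apply: leq_trans (hle (Ordinal ltax)) _ => /=.
by rewrite height_leq ?xP // -em.
Qed.

Local Open Scope ring_scope.

(** * Generating functions of paths with weighted east steps *)

Lemma sum_tuple_rcons (R : nmodType) (n : nat) (F : seq step -> R) :
  \sum_(P : n.+1.-tuple step) F P =
  \sum_(P : n.-tuple step) (F (rcons P North) + F (rcons P East)).
Proof.
pose f (p : n.-tuple step * step) : n.+1.-tuple step := [tuple of rcons p.1 p.2].
have f_inj : injective f.
  move=> [p c] [q d] /(congr1 val) /= e.
  by have [/val_inj -> ->] := rcons_inj e.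
have f_bij : bijective f.
  by apply: inj_card_bij => //; rewrite card_prod !card_tuple expnSr.
rewrite (reindex f) /=; last exact: onW_bij.
rewrite -(pair_bigA _ (fun (p : n.-tuple step) c => F (rcons p c))) /=; apply: eq_bigr => p _.
rewrite (bigD1 North) //= (bigD1 East) //= big1 ?addr0 //.
by case.
Qed.

(** The function g_i(k) for arbitrary weights: a path is cut at its last east step, of height [j],
    after which it only goes north. *)
Fixpoint path_sum (R : comNzRingType) (w : nat -> nat -> R) (i k : nat) : R :=
  if i is i'.+1 then \sum_(j < k.+1) w i' j * path_sum w i' j else 1.

Lemma path_sumSS (R : comNzRingType) (w : nat -> nat -> R) (i k : nat) :
  path_sum w i.+1 k.+1 =
  path_sum w i.+1 k + w i k.+1 * path_sum w i k.+1.
Proof. by rewrite /= big_ord_recr. Qed.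

Lemma path_sumS0 (R : comNzRingType) (w : nat -> nat -> R) (i : nat) :
  path_sum w i.+1 0 = w i 0 * path_sum w i 0.
Proof. by rewrite /= big_ord1. Qed.

Lemma endpoint_rcons (s : seq step) (c : step) :
  endpoint (rcons s c) =
  if c is East then ((endpoint s).1.+1, (endpoint s).2)
  else ((endpoint s).1, (endpoint s).2.+1).
Proof.
by rewrite /endpoint -cats1 !count_cat; case: c; rewrite /= !addn0 !addn1.
Qed.

(** Induction on the length, splitting by the last step: the two classes of paths give the two terms
    of [path_sumSS]. *)
Lemma path_sumE (R : comNzRingType) (w : nat -> nat -> R) (i k : nat) :
  \sum_(P : (i + k).-tuple step | is_path_to i k P)
     \prod_(p <- east_steps P) w p.1 p.2 = path_sum w i k.
Proof.
move en : (i + k)%N => n; elim: n i k en => [|n IHn] i k en.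
  have [-> ->] : i = 0 /\ k = 0 by lia.
  by rewrite (big_pred1 [tuple]) ?big_nil // => P; rewrite tuple0.
rewrite big_mkcond.
rewrite (sum_tuple_rcons _ (fun P => if is_path_to i k P
  then \prod_(p <- east_steps P) w p.1 p.2 else 0)) big_split /=.
have -> : \sum_(P : n.-tuple step) (if is_path_to i k (rcons P North)
    then \prod_(p <- east_steps (rcons P North)) w p.1 p.2 else 0) =
    if k is k'.+1 then path_sum w i k' else 0.
  case: k en => [|k] en.
    by rewrite big1 // => P _; rewrite /is_path_to endpoint_rcons xpair_eqE andbF.
  rewrite -(IHn i k) ?[RHS]big_mkcond; last by lia.
  apply: eq_bigr => P _; rewrite /is_path_to endpoint_rcons east_steps_rcons cats0.
  by case: (endpoint P) => a b; rewrite !xpair_eqE eqSS.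
have -> : \sum_(P : n.-tuple step) (if is_path_to i k (rcons P East)
    then \prod_(p <- east_steps (rcons P East)) w p.1 p.2 else 0) =
    if i is i'.+1 then w i' k * path_sum w i' k else 0.
  case: i en => [|i] en.
    by rewrite big1 // => P _; rewrite /is_path_to endpoint_rcons xpair_eqE.
  rewrite -(IHn i k) ?[\sum_(P | is_path_to i k _) _]big_mkcond; last by lia.
  rewrite mulr_sumr; apply: eq_bigr => P _.
  rewrite /is_path_to endpoint_rcons east_steps_rcons big_cat.
  case: (endpoint P) => a b; rewrite big_seq1 /= !xpair_eqE eqSS.
  by case: andP => [[/eqP -> /eqP ->]|_]; [rewrite mulrC|rewrite mulr0].
case: i k en => [|i] [|k] // en; rewrite ?addr0 ?add0r ?path_sumS0 ?path_sumSS //.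
Qed.

(** * Exchange of the two contact weights *)

(* The weight of an east step at height [k] when the corresponding steps of B and
   T have heights [b] and [t]. *)
Definition contact_weight (R : comNzRingType) (u v : R) (b t k : nat) : R :=
  if (b <= k <= t)%N then u ^+ (k == t) * v ^+ (k == b) else 0.

(** Using the same [h] in the first two clauses, which [u] and [v] exchange, encodes the invariance
    of [h]. *)
Definition coupled (R : comNzRingType) (u v : R) (b t : nat) (g g' h : nat -> R) :=
  [/\ forall k, (b <= k)%N -> g k.+1 = g k + u * h k + (1 - u) * h k.+1,
      forall k, (b <= k)%N -> g' k.+1 = g' k + v * h k + (1 - v) * h k.+1,
      forall k, g k = g' k + (v - u) * h k
    & forall k, (t <= k)%N -> h k = 0].

Definition coupling_step (R : comNzRingType) (u : R) (b t : nat) (g h : nat -> R)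
    (k : nat) : R :=
  if (b <= k < t)%N then g k + u * h k else 0.

(** Height [k.+1] exceeds [b], so no factor [v] occurs. Below [t] the weight is 1; at [t] it is [u]
    and the terms at [k.+1] vanish; above [t] both sides are 0. *)
Lemma contact_weight_mulS (R : comNzRingType) (u v : R) (b t : nat)
    (g h : nat -> R) (k : nat) :
  g k.+1 = g k + u * h k + (1 - u) * h k.+1 ->
  (forall k, (t <= k)%N -> h k = 0) -> (b <= k)%N ->
  contact_weight u v b t k.+1 * g k.+1 =
  u * coupling_step u b t g h k + (1 - u) * coupling_step u b t g h k.+1.
Proof.
move=> dg h0 le_bk; rewrite /contact_weight /coupling_step le_bk leqW //=.
have -> : (k.+1 == b) = false by lia.
case: (ltngtP k.+1 t) => [lt_kt|gt_kt|eq_kt] /=.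
- by rewrite dg !expr0; ring.
- by ring.
- by rewrite dg (h0 k.+1) ?eq_kt //; ring.
Qed.

Lemma coupled_step (R : comNzRingType) (u v : R) (b t : nat)
    (g g' h g1 g1' : nat -> R) :
  coupled u v b t g g' h ->
  g1 0%N = contact_weight u v b t 0 * g 0%N ->
  (forall k, g1 k.+1 = g1 k + contact_weight u v b t k.+1 * g k.+1) ->
  g1' 0%N = contact_weight v u b t 0 * g' 0%N ->
  (forall k, g1' k.+1 = g1' k + contact_weight v u b t k.+1 * g' k.+1) ->
  coupled u v b t g1 g1' (coupling_step u b t g h).
Proof.
move=> [dg dg' gg' h0] g10 g1S g1'0 g1'S.
(* The relation between [g] and [g'] gives g + u h = g' + v h, so the new function is again
   invariant. *)
have swap k : coupling_step u b t g h k = coupling_step v b t g' h k.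
  by rewrite /coupling_step gg'; case: ifP => // _; ring.
have wg k : (b <= k)%N -> contact_weight u v b t k.+1 * g k.+1 =
    u * coupling_step u b t g h k + (1 - u) * coupling_step u b t g h k.+1.
  by move=> le_bk; apply: contact_weight_mulS; auto.
have wg' k : (b <= k)%N -> contact_weight v u b t k.+1 * g' k.+1 =
    v * coupling_step u b t g h k + (1 - v) * coupling_step u b t g h k.+1.
  by move=> le_bk; rewrite !swap; apply: contact_weight_mulS; auto.
(* Only k = b matters: if b < t the weights are [v] and [u], if b = t both are u v and [h]
   vanishes. *)
have first_diff k : (k <= b)%N ->
    contact_weight u v b t k * g k =
    contact_weight v u b t k * g' k + (v - u) * coupling_step u b t g h k.
  rewrite /contact_weight /coupling_step gg' leq_eqVlt.
  case/orP=> [/eqP ->|lt_kb]; last by rewrite leqNgt lt_kb /=; ring.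
  rewrite leqnn eqxx /=; case: ltngtP => [lt_bt|gt_bt|eq_bt] /=.
  - by ring.
  - by ring.
  - by rewrite h0 ?eq_bt //; ring.
split=> [k le_bk|k le_bk|k|k le_tk].
- by rewrite g1S wg //; ring.
- by rewrite g1'S wg' //; ring.
(* From [b] on, the increments of [g1] and [g1'] differ by v - u times the increment of the new
   function, so the sum telescopes. *)
- elim: k => [|k IHk]; first by rewrite g10 g1'0 first_diff.
  rewrite g1S g1'S IHk; have [le_bk|lt_kb] := leqP b k.
    by rewrite wg // wg' //; ring.
  rewrite first_diff //.
  have -> : coupling_step u b t g h k = 0 by rewrite /coupling_step leqNgt lt_kb.
  by ring.
- by rewrite /coupling_step [(k < t)%N]ltnNge le_tk andbF.
Qed.

Lemma path_sum_coupled (R : comNzRingType) (u v : R) (b t : nat -> nat) (i : nat) :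
  (forall a, b a <= b a.+1)%N -> (forall a, t a <= t a.+1)%N ->
  exists h, coupled u v (b i) (t i)
    (path_sum (fun a => contact_weight u v (b a) (t a)) i)
    (path_sum (fun a => contact_weight v u (b a) (t a)) i) h.
Proof.
move=> b_leS t_leS; elim: i => [|i [h IHi]].
  by exists (fun=> 0); split=> * //=; ring.
set w := fun a => contact_weight u v (b a) (t a).
set w' := fun a => contact_weight v u (b a) (t a).
have [dg dg' gg' h0] := coupled_step IHi (path_sumS0 w i) (path_sumSS w i)
  (path_sumS0 w' i) (path_sumSS w' i).
(* The relations hold from [b i] and [t i] on, hence from the larger bounds of the next column. *)
exists (coupling_step u (b i) (t i) (path_sum w i) h); split=> // k hk.
- exact/dg/(leq_trans (b_leS i)).
- exact/dg'/(leq_trans (b_leS i)).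
- exact/h0/(leq_trans (t_leS i)).
Qed.

Lemma path_sum_symmetric (R : comNzRingType) (u v : R) (b t : nat -> nat) (i k : nat) :
  (forall a, b a <= b a.+1)%N -> (forall a, t a <= t a.+1)%N -> (t i <= k)%N ->
  path_sum (fun a => contact_weight u v (b a) (t a)) i k =
  path_sum (fun a => contact_weight v u (b a) (t a)) i k.
Proof.
move=> b_leS t_leS le_tk.
have [h [_ _ -> ->]] := path_sum_coupled u v i b_leS t_leS; last by [].
by rewrite mulr0 addr0.
Qed.

(** * Paths between [B] and [T] as a weighted path sum *)

Lemma big_east_steps (R : Type) (idx : R) (op : R -> R -> R) (x y : nat)
    (P : seq step) (F : nat * nat -> R) : is_path_to x y P ->
  \big[op/idx]_(p <- east_steps P) F p = \big[op/idx]_(a < x) F (nat_of_ord a, height P a).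
Proof.
move=> /eqP[xP _]; rewrite east_stepsE big_map xP.
by have -> : iota 0 x = index_iota 0 x; rewrite ?big_mkord // /index_iota subn0.
Qed.

Lemma contactsE (x y : nat) (P Q : seq step) : is_path_to x y P -> is_path_to x y Q ->
  contacts P Q = (\sum_(a < x) (height P a == height Q a))%N.
Proof.
move=> hP hQ; rewrite /contacts -sum1_count big_mkcond (big_east_steps _ _ _ hP).
apply: eq_bigr => a _; rewrite mem_east_steps; first by case: eqP.
by case/eqP: hQ => -> _.
Qed.

(** A single height outside its interval annihilates the product; otherwise the exponents add up to
    the numbers of contacts. *)
Lemma prod_contact_weight (R : comNzRingType) (u v : R) (x y : nat) (T B P : seq step) :
  is_path_to x y T -> is_path_to x y B -> is_path_to x y P ->
  \prod_(p <- east_steps P) contact_weight u v (height B p.1) (height T p.1) p.2 =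
  if weakly_above P B && weakly_above T P
  then u ^+ contacts P T * v ^+ contacts P B else 0.
Proof.
move=> hT hB hP; rewrite (big_east_steps _ _ _ hP) /=.
rewrite (weakly_above_height hP hB) (weakly_above_height hT hP).
rewrite (contactsE hP hT) (contactsE hP hB).
case: ifPn => [/andP[/forallP hBP /forallP hPT]|].
  rewrite !expr_sum -big_split /=; apply: eq_bigr => a _.
  by rewrite /contact_weight hBP hPT.
rewrite negb_and !negb_forall => /orP[] /existsP[a ha];
  rewrite (bigD1 a) //= /contact_weight (negPf ha) ?andbF mul0r //.
Qed.

Lemma sum_paths_between (R : comNzRingType) (u v : R) (x y : nat) (T B : seq step) :
  is_path_to x y T -> is_path_to x y B ->
  \sum_(P in paths_between x y T B) u ^+ contacts P T * v ^+ contacts P B =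
  path_sum (fun a => contact_weight u v (height B a) (height T a)) x y.
Proof.
move=> hT hB; rewrite -path_sumE big_mkcond [RHS]big_mkcond.
apply: eq_bigr => P _; rewrite inE; case: ifPn => [/andP[hP above]|].
  by rewrite hP (prod_contact_weight _ _ hT hB hP) above.
by case: ifP => //= hP /negPf above; rewrite (prod_contact_weight _ _ hT hB hP) above.
Qed.

Theorem theorem2p1 (R : comNzRingType) (u v : R) (x y : nat) (T B : seq step)
    (hT : is_path_to x y T) (hB : is_path_to x y B) (hTB : weakly_above T B) :
  \sum_(P in paths_between x y T B) u ^+ contacts P T * v ^+ contacts P B =
  \sum_(P in paths_between x y T B) u ^+ contacts P B * v ^+ contacts P T.
Proof.
under [RHS]eq_bigr do rewrite mulrC.
rewrite !sum_paths_between //; apply: path_sum_symmetric; try exact: height_leS.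
(* [T] has no east step of index [x]; the default value of [height T x] is still at most [y], so h
   vanishes at the endpoint. *)
by apply: leq_trans (height_le_count _ _) _; case/eqP: hT => _ ->.
Qed.
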